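(* Let $k\ge0$ be an integer and $\alpha\ge1$. If $\beta\in[b_{2k},b_{2k-1}]$ (with $\beta<\infty$), then $$\sup_{n\ge-1}\Gamma_{\alpha,\beta}(FM_n)=\max\{\Gamma_{\alpha,\beta}(FM_{-1}),\Gamma_{\alpha,\beta}(FM_0),\ldots,\Gamma_{\alpha,\beta}(FM_{2k-1})\},$$ and if $\beta\in[b_{2k+1},b_{2k}]$, then $$\sup_{n\ge-1}\Gamma_{\alpha,\beta}(FM_n)=\max\{\Gamma_{\alpha,\beta}(FM_{-1}),\Gamma_{\alpha,\beta}(FM_0),\ldots,\Gamma_{\alpha,\beta}(FM_{2k-1}),\Gamma_{\alpha,\beta}(FM_{2k+1})\}.$$ (The suprema are over integers $n\ge-1$.)
   Context: Pell numbers $P_n$ and half-companion Pell numbers $H_n$: $P_0=0,P_1=1$, $H_0=H_1=1$, $P_{n+2}=2P_{n+1}+P_n$, $H_{n+2}=2H_{n+1}+H_n$; also $P_{-1}=1$, $H_{-1}=-1$. For a class written $A=(a,b;\mathcal W(c,d))$ with $a,b,c,d$ nonnegative integers, $c,d>0$, and $\alpha,\beta\geq 1$, set $\Gamma_{\alpha,\beta}(A)=\frac{d\alpha}{a+\beta b}$ if $\alpha\le\frac cd$ and $\Gamma_{\alpha,\beta}(A)=\frac{c}{a+\beta b}$ if $\alpha\ge\frac cd$ (so $\Gamma$ depends only on $(a,b,c,d)$). For $n\ge-1$, $FM_n=(P_{n+1},P_{n+1};\mathcal W(H_{n+2},H_n))$ for $n$ even, and $FM_n=\left(\frac{H_{n+1}+1}{2},\frac{H_{n+1}-1}{2};\mathcal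 W(P_{n+2},P_n)\right)$ for $n$ odd. Set $b_{-1}=\infty$ and, for $n\ge0$, $b_n=1+\frac{2}{P_{n+2}-1}$ if $n$ is even, $b_n=1+\frac{2}{H_{n+1}-1}$ if $n$ is odd. This is a strictly decreasing sequence converging to $1$. *)

(* Defs.v *)
From HB Require Import structures.
From mathcomp Require Import all_boot all_order all_algebra.
From mathcomp Require Import zify ring lra.
From mathcomp Require Import all_classical all_reals all_analysis.

Set Implicit Arguments.
Unset Strict Implicit.
Unset Printing Implicit Defensive.

Import Order.TTheory GRing.Theory Num.Theory.
Local Open Scope ring_scope.

Fixpoint pell_nat (n : nat) : nat :=
  match n with
  | 0 => 0
  | m.+1 => match m with 0 => 1 | l.+1 => 2 * pell_nat m + pell_nat l end
  end%N.

Fixpoint hpell_nat (n : nat) : nat :=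
  match n with
  | 0 => 1
  | m.+1 => match m with 0 => 1 | l.+1 => 2 * hpell_nat m + hpell_nat l end
  end%N.

Lemma pell_natSS n : pell_nat n.+2 = (2 * pell_nat n.+1 + pell_nat n)%N.
Proof. by []. Qed.

Lemma hpell_natSS n : hpell_nat n.+2 = (2 * hpell_nat n.+1 + hpell_nat n)%N.
Proof. by []. Qed.

(* The recurrence run backwards gives P_(-m) = (-1)^(m+1) P_m and
   H_(-m) = (-1)^m H_m; recall that Negz m is -(m+1). *)
Definition P (n : int) : int :=
  match n with
  | Posz m => (pell_nat m)%:Z
  | Negz m => (-1) ^+ m * (pell_nat m.+1)%:Z
  end.

Definition H (n : int) : int :=
  match n with
  | Posz m => (hpell_nat m)%:Z
  | Negz m => (-1) ^+ m.+1 * (hpell_nat m.+1)%:Z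
  end.

Lemma P_rec (n : int) : P (n + 2) = 2 * P (n + 1) + P n.
Proof.
case: n => [m|[|[|m]]] //.
  have -> : Posz m + 2 = Posz m.+2 by lia.
  have -> : Posz m + 1 = Posz m.+1 by lia.
  by rewrite /P pell_natSS PoszD PoszM.
have -> : Negz m.+2 + 2 = Negz m by lia.
have -> : Negz m.+2 + 1 = Negz m.+1 by lia.
rewrite /P (pell_natSS m.+1) PoszD PoszM !exprS; ring.
Qed.

Lemma H_rec (n : int) : H (n + 2) = 2 * H (n + 1) + H n.
Proof.
case: n => [m|[|[|m]]] //.
  have -> : Posz m + 2 = Posz m.+2 by lia.
  have -> : Posz m + 1 = Posz m.+1 by lia.
  by rewrite /H hpell_natSS PoszD PoszM.
have -> : Negz m.+2 + 2 = Negz m by lia.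
have -> : Negz m.+2 + 1 = Negz m.+1 by lia.
rewrite /H (hpell_natSS m.+1) PoszD PoszM !exprS; ring.
Qed.

Example PH_init : [/\ P 0 = 0, P 1 = 1, H 0 = 1 & H 1 = 1] /\
                  (P (-1) = 1 /\ H (-1) = -1).
Proof. by []. Qed.

(* The class (a, b; W(c, d)). *)
Record qclass := QClass {
  cls_a : int;
  cls_b : int;
  cls_c : int;
  cls_d : int
}.

(* The two formulas agree at alpha = c / d. *)
Definition Gamma (R : realType) (alpha beta : R) (A : qclass) : R :=
  let a := (cls_a A)%:~R in
  let b := (cls_b A)%:~R in
  let c := (cls_c A)%:~R in
  let d := (cls_d A)%:~R in
  if alpha <= c / d then d * alpha / (a + beta * b) else c / (a + beta * b).

(* The divisions by 2 are exact, H being odd (see H_odd); only n >= -1 is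
   meaningful. *)
Definition FM (n : int) : qclass :=
  if (2 %| n)%Z then
    QClass (P (n + 1)) (P (n + 1)) (H (n + 2)) (H n)
  else
    QClass ((H (n + 1) + 1) %/ 2)%Z ((H (n + 1) - 1) %/ 2)%Z
           (P (n + 2)) (P n).

Lemma H_odd (n : int) : -1 <= n -> ~~ (2 %| H n)%Z.
Proof.
have odd2 m : odd (hpell_nat m) && odd (hpell_nat m.+1).
  elim: m => [//|m /andP[h0 h1]]; rewrite h1 hpell_natSS.
  by rewrite oddD oddM h0.
case: n => [m _|[|m]] //.
by have /andP[h _] := odd2 m; rewrite /H dvdzE dvdn2 negbK.
Qed.

Lemma FM_wf (n : int) : -1 <= n ->
  [/\ 0 <= cls_a (FM n), 0 <= cls_b (FM n), 0 < cls_c (FM n)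
    & 0 < cls_d (FM n)].
Proof.
have Hpos m : (0 < hpell_nat m)%N && (0 < hpell_nat m.+1)%N.
  by elim: m => [//|m /andP[h0 h1]]; rewrite h1 ?hpell_natSS ?pell_natSS; lia.
have Ppos m : (0 < pell_nat m.+1)%N && (0 < pell_nat m.+2)%N.
  by elim: m => [//|m /andP[h0 h1]]; rewrite h1 ?hpell_natSS ?pell_natSS; lia.
case: n => [m _|[_|m]] //.
rewrite /FM.
have -> : Posz m + 2 = Posz m.+2 by lia.
have -> : Posz m + 1 = Posz m.+1 by lia.
have [/andP[h0 h1] /andP[h2 _] /andP[p0 p1]] := And3 (Hpos m) (Hpos m.+2) (Ppos m).
case: ifPn => [_|m_odd]; split; rewrite /cls_a /cls_b /cls_c /cls_d /P /H.
all: try lia.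
by case: m m_odd {h0 h1 h2 p0 p1} => [|m] // _; have /andP[] := Ppos m; lia.
Qed.

Definition b_thr (R : realType) (n : int) : \bar R :=
  if n == -1 then +oo%E
  else if (2 %| n)%Z then (1 + 2 / ((P (n + 2))%:~R - 1))%:E
  else (1 + 2 / ((H (n + 1))%:~R - 1))%:E.

(* Main.v *)
Require Import Defs.
From HB Require Import structures.
From mathcomp Require Import all_boot all_order all_algebra.
From mathcomp Require Import zify ring lra.
From mathcomp Require Import all_classical all_reals all_analysis.

Import Order.TTheory GRing.Theory Num.Theory.
Local Open Scope classical_set_scope.
Local Open Scope ring_scope.

(** For fixed beta, alpha |-> Gamma alpha beta A is min(d alpha, c) / (a + beta b),
so one class dominates another for every alpha as soon as it has the larger
slope d / (a + beta b) and the larger plateau c / (a + beta b). The slope of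
FM_(2k-1) is at least those of FM_(2k) and FM_(2k+1) whenever beta >= 1. Using
H_(2k)^2 - 2 P_(2k)^2 = 1, its plateau is at least that of FM_(2k) exactly when
beta >= b_(2k+1), and at least that of FM_(2k+1) exactly when beta >= b_(2k). As
b is decreasing, beta >= b_(2k) makes FM_(2k-1) dominate every later class, and
beta >= b_(2k+1) makes FM_(2k+1) dominate every later class and FM_(2k-1)
dominate FM_(2k). *)

#[local] Arguments P : simpl never.
#[local] Arguments H : simpl never.

(** * Pell arithmetic in the ring of integers extended by sqrt 2 *)

Lemma PS_HS (n : nat) : P n.+1 = P n + H n /\ H n.+1 = 2 * P n + H n.
Proof.
suff [] : pell_nat n.+1 = (pell_nat n + hpell_nat n)%N /\
          hpell_nat n.+1 = (2 * pell_nat n + hpell_nat n)%N.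
  by rewrite /P /H; lia.
elim: n => [//|n [IHp IHh]].
by rewrite pell_natSS hpell_natSS; lia.
Qed.

Lemma PS (n : nat) : P n.+1 = P n + H n.
Proof. by have [] := PS_HS n. Qed.

Lemma HS (n : nat) : H n.+1 = 2 * P n + H n.
Proof. by have [] := PS_HS n. Qed.

(** Two index steps multiply [H n + P n * sqrt 2] by (1 + sqrt 2)^2 = 3 + 2 sqrt 2. *)
Lemma PSS (n : nat) : P n.+2 = 3 * P n + 2 * H n.
Proof. by rewrite !PS HS; ring. Qed.

Lemma HSS (n : nat) : H n.+2 = 4 * P n + 3 * H n.
Proof. by rewrite !HS PS; ring. Qed.

Lemma P_ge0 (n : nat) : 0 <= P n.
Proof. by []. Qed.

Lemma H_ge1 (n : nat) : 1 <= H n.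
Proof. by elim: n => [//|n IH]; rewrite HS; have := P_ge0 n; lia. Qed.

(** The norm of 1 + sqrt 2 is -1, so its even powers have norm 1. *)
Lemma pell_norm (k : nat) : H (2 * k)%N ^+ 2 = 2 * P (2 * k)%N ^+ 2 + 1.
Proof.
elim: k => [//|k IH].
have -> : (2 * k.+1)%N = (2 * k).+2 by lia.
by rewrite PSS HSS; nia.
Qed.

Lemma Gamma_le (R : realType) (alpha beta : R) (A B : qclass) :
  let v C := (cls_a C)%:~R + beta * (cls_b C)%:~R in
  0 <= alpha -> 0 < cls_d A -> 0 < cls_d B -> 0 < v A -> 0 < v B ->
  (cls_d A)%:~R * v B <= (cls_d B)%:~R * v A ->
  (cls_c A)%:~R * v B <= (cls_c B)%:~R * v A ->
  Gamma alpha beta A <= Gamma alpha beta B.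
Proof.
move=> v al0 dA0 dB0 vA0 vB0 hd hc.
have GE C : 0 < cls_d C -> Gamma alpha beta C =
    Num.min ((cls_d C)%:~R * alpha) (cls_c C)%:~R / v C.
  move=> dC0; rewrite /Gamma /v /=.
  have d0 : 0 < (cls_d C)%:~R :> R by rewrite ltr0z.
  by rewrite ler_pdivlMr // mulrC; case: leP.
rewrite !GE // ler_pdivrMr // mulrAC ler_pdivlMr //.
(* Split on which term is the minimum for [B], and bound the minimum for [A] by the same term. *)
case: (leP ((cls_d B)%:~R * alpha)) => _.
  apply: (@le_trans _ _ ((cls_d A)%:~R * alpha * v B)).
    by rewrite ler_wpM2r ?(ltW vB0) // ge_min lexx.
  by rewrite mulrAC [leRHS]mulrAC ler_wpM2r.
apply: le_trans hc.
by rewrite ler_wpM2r ?(ltW vB0) // ge_min lexx orbT.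
Qed.

(** * Classes and weights in terms of [P (2 * k)] and [H (2 * k)] *)

Lemma FM_even (k : nat) : FM (2 * k%:Z) =
  let p := P (2 * k)%N in let h := H (2 * k)%N in
  QClass (p + h) (p + h) (4 * p + 3 * h) h.
Proof.
rewrite /FM; case: ifPn => [_|]; last by rewrite dvdz_mulr.
have -> : 2 * k%:Z + 1 = (2 * k).+1 by lia.
have -> : 2 * k%:Z + 2 = (2 * k).+2 by lia.
have -> : 2 * k%:Z = (2 * k)%N by lia.
by rewrite PS HSS; congr QClass; ring.
Qed.

Lemma FM_odd (k : nat) : FM (2 * k%:Z - 1) =
  let p := P (2 * k)%N in let h := H (2 * k)%N in
  QClass ((h + 1) %/ 2)%Z ((h - 1) %/ 2)%Z (p + h) (h - p).
Proof.
rewrite /FM; case: ifPn => [|_]; first by lia.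
(* The recurrence over the integers gives P_(2k-1) = h - p even for k = 0, where the index is -1. *)
have := P_rec (2 * k%:Z - 1).
have -> : 2 * k%:Z - 1 + 2 = (2 * k).+1 by lia.
have -> : 2 * k%:Z - 1 + 1 = (2 * k)%N by lia.
by rewrite PS => e /=; congr QClass; lia.
Qed.

Lemma FM_odd_weight (R : realType) (beta : R) (k : nat) :
  let h := (H (2 * k)%N)%:~R : R in
  (cls_a (FM (2 * k%:Z - 1)))%:~R + beta * (cls_b (FM (2 * k%:Z - 1)))%:~R
  = h + (beta - 1) * ((h - 1) / 2).
Proof.
rewrite /= FM_odd /=.
(* Oddness makes both integer halves exact. *)
have hodd : ~~ (2 %| H (2 * k)%N)%Z by apply: H_odd.
have [u ->] : exists u, H (2 * k)%N = 2 * u + 1.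
  by exists (H (2 * k)%N %/ 2)%Z; lia.
have -> : ((2 * u + 1 + 1) %/ 2)%Z = u + 1 by lia.
have -> : ((2 * u + 1 - 1) %/ 2)%Z = u by lia.
by rewrite !intrD intrM; field.
Qed.

Lemma P_le_H (n : nat) : P n <= H n.
Proof. by elim: n => [//|n IH]; rewrite PS HS; have := P_ge0 n; lia. Qed.

Lemma P_lt_H_even (k : nat) : P (2 * k)%N < H (2 * k)%N.
Proof.
by have := pell_norm k; have := P_ge0 (2 * k); have := H_ge1 (2 * k); nia.
Qed.

(** * Polynomial inequalities in p, h and t = beta - 1 *)

Lemma weight_odd_gt0 (R : realFieldType) (h t : R) :
  1 <= h -> 0 <= t -> 0 < h + t * ((h - 1) / 2).
Proof.
move=> h1 t0; have th : 0 <= t * (h - 1) by rewrite mulr_ge0 ?subr_ge0.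
by lra.
Qed.

Lemma weight_even_gt0 (R : realFieldType) (p h t : R) :
  0 <= p -> 1 <= h -> 0 <= t -> 0 < (p + h) * (2 + t).
Proof. by move=> p0 h1 t0; rewrite mulr_gt0 //; lra. Qed.

(** Modulo the norm equation, right minus left is 1 + t (h + 1) / 2. *)
Lemma slope_even_le (R : realFieldType) (p h t : R) :
  h ^+ 2 = 2 * p ^+ 2 + 1 -> 1 <= h -> 0 <= t ->
  h * (h + t * ((h - 1) / 2)) <= (h - p) * ((p + h) * (2 + t)).
Proof.
move=> norm h1 t0; have th : 0 <= t * (h - 1) by rewrite mulr_ge0 ?subr_ge0.
(* Linear arithmetic treats monomials as atoms, so the norm equation is also supplied multiplied by
   t. *)
have norm_t : (h ^+ 2 - 2 * p ^+ 2 - 1) * t = 0 by rewrite norm; ring.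
by lra.
Qed.

(** Right minus left is (t (4p + 3h - 1) - 2) / 2, whence the sharp threshold. *)
Lemma plateau_even_le (R : realFieldType) (p h t : R) :
  h ^+ 2 = 2 * p ^+ 2 + 1 -> 2 <= t * (4 * p + 3 * h - 1) ->
  (4 * p + 3 * h) * (h + t * ((h - 1) / 2)) <= (p + h) * ((p + h) * (2 + t)).
Proof.
move=> norm ht.
have norm_t : (h ^+ 2 - 2 * p ^+ 2 - 1) * t = 0 by rewrite norm; ring.
by lra.
Qed.

(** Right minus left is 2 + t (p + 1). *)
Lemma slope_odd_le (R : realFieldType) (p h t : R) :
  h ^+ 2 = 2 * p ^+ 2 + 1 -> 0 <= p -> 0 <= t ->
  (p + h) * (h + t * ((h - 1) / 2))
  <= (h - p) * (4 * p + 3 * h + t * ((4 * p + 3 * h - 1) / 2)).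
Proof.
move=> norm p0 t0; have tp : 0 <= t * p by rewrite mulr_ge0.
have norm_t : (h ^+ 2 - 2 * p ^+ 2 - 1) * t = 0 by rewrite norm; ring.
by lra.
Qed.

(** Right minus left is t (3p + 2h - 1) - 2. *)
Lemma plateau_odd_le (R : realFieldType) (p h t : R) :
  h ^+ 2 = 2 * p ^+ 2 + 1 -> 2 <= t * (3 * p + 2 * h - 1) ->
  (7 * p + 5 * h) * (h + t * ((h - 1) / 2))
  <= (p + h) * (4 * p + 3 * h + t * ((4 * p + 3 * h - 1) / 2)).
Proof.
move=> norm ht.
have norm_t : (h ^+ 2 - 2 * p ^+ 2 - 1) * t = 0 by rewrite norm; ring.
by lra.
Qed.

Lemma pell_norm_cast (R : pzRingType) (k : nat) :
  (H (2 * k)%N)%:~R ^+ 2 = 2 * (P (2 * k)%N)%:~R ^+ 2 + 1 :> R.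
Proof.
have /(congr1 (fun z : int => z%:~R : R)) := pell_norm k.
by rewrite intrD intrM !rmorphXn.
Qed.

(** * Domination between the classes, with the thresholds cleared of denominators *)

Section Domination.

Variables (R : realType) (alpha beta : R).
Hypothesis alpha_ge0 : 0 <= alpha.
Hypothesis beta_ge1 : 1 <= beta.

Let t_ge0 : 0 <= beta - 1.
Proof. by rewrite subr_ge0. Qed.

Let P_cast_ge0 (n : nat) : 0 <= (P n)%:~R :> R.
Proof. by rewrite ler0z. Qed.

Let H_cast_ge1 (n : nat) : 1 <= (H n)%:~R :> R.
Proof. by rewrite ler1z H_ge1. Qed.

Lemma FM_even_weight (k : nat) :
  (cls_a (FM (2 * k%:Z)))%:~R + beta * (cls_b (FM (2 * k%:Z)))%:~R
  = ((P (2 * k)%N)%:~R + (H (2 * k)%N)%:~R) * (2 + (beta - 1)) :> R.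
Proof. by rewrite FM_even /= intrD; ring. Qed.

Lemma Gamma_FM_even_le (k : nat) :
  2 <= (beta - 1) * ((H (2 * k).+2)%:~R - 1) ->
  Gamma alpha beta (FM (2 * k%:Z)) <= Gamma alpha beta (FM (2 * k%:Z - 1)).
Proof.
have -> : (H (2 * k).+2)%:~R =
    4 * (P (2 * k)%N)%:~R + 3 * (H (2 * k)%N)%:~R :> R.
  by rewrite HSS !(intrD, intrM).
move=> hb; apply: Gamma_le; rewrite ?FM_odd_weight ?FM_even_weight //.
- by rewrite FM_even /=; have := H_ge1 (2 * k); lia.
- by rewrite FM_odd /= subr_gt0 P_lt_H_even.
- exact: weight_even_gt0.
- exact: weight_odd_gt0.
- rewrite FM_even FM_odd /= intrB.
  by apply: slope_even_le; rewrite ?pell_norm_cast.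
- rewrite FM_even FM_odd /= !(intrD, intrM).
  by apply: plateau_even_le; rewrite ?pell_norm_cast.
Qed.

Lemma Gamma_FM_odd_le (k : nat) :
  2 <= (beta - 1) * ((P (2 * k).+2)%:~R - 1) ->
  Gamma alpha beta (FM (2 * k%:Z + 1)) <= Gamma alpha beta (FM (2 * k%:Z - 1)).
Proof.
have -> : (P (2 * k).+2)%:~R =
    3 * (P (2 * k)%N)%:~R + 2 * (H (2 * k)%N)%:~R :> R.
  by rewrite PSS !(intrD, intrM).
move=> hb; have -> : 2 * k%:Z + 1 = 2 * k.+1%:Z - 1 by lia.
have k2 : (2 * k.+1)%N = (2 * k).+2 by lia.
have H2 : H (2 * k.+1)%N = 4 * P (2 * k)%N + 3 * H (2 * k)%N.
  by rewrite k2 HSS.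
have HsubP : H (2 * k.+1)%N - P (2 * k.+1)%N = P (2 * k)%N + H (2 * k)%N.
  by rewrite k2 HSS PSS; ring.
have PaddH : P (2 * k.+1)%N + H (2 * k.+1)%N = 7 * P (2 * k)%N + 5 * H (2 * k)%N.
  by rewrite k2 HSS PSS; ring.
apply: Gamma_le; rewrite ?FM_odd_weight //.
- by rewrite FM_odd /= subr_gt0 P_lt_H_even.
- by rewrite FM_odd /= subr_gt0 P_lt_H_even.
- exact: weight_odd_gt0.
- exact: weight_odd_gt0.
- rewrite !FM_odd /= HsubP intrB intrD H2 !(intrD, intrM).
  by apply: slope_odd_le; rewrite ?pell_norm_cast.
- rewrite !FM_odd /= PaddH H2 !(intrD, intrM).
  by apply: plateau_odd_le; rewrite ?pell_norm_cast.
Qed.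

Lemma Gamma_FM_le (k : nat) (n : int) :
  2 <= (beta - 1) * ((P (2 * k).+2)%:~R - 1) -> 2 * k%:Z - 1 <= n ->
  Gamma alpha beta (FM n) <= Gamma alpha beta (FM (2 * k%:Z - 1)).
Proof.
move=> hk kn.
(* The threshold condition passes to later j because P grows along even indices. *)
have hP j : (k <= j)%N -> 2 <= (beta - 1) * ((P (2 * j).+2)%:~R - 1).
  elim: j => [|j IH]; first by rewrite leqn0 => /eqP k0; rewrite k0 in hk.
  rewrite leq_eqVlt => /predU1P[<- //|/IH] hj.
  apply: le_trans hj _; rewrite ler_wpM2l ?subr_ge0 // lerD2r ler_int.
  have -> : (2 * j.+1)%N = (2 * j).+2 by lia.
  by rewrite [leRHS]PSS; have := P_ge0 (2 * j).+2; have := H_ge1 (2 * j).+2; lia.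
have odd_le j : (k <= j)%N -> Gamma alpha beta (FM (2 * j%:Z - 1)) <=
                             Gamma alpha beta (FM (2 * k%:Z - 1)).
  elim: j => [|j IH]; first by rewrite leqn0 => /eqP ->.
  rewrite leq_eqVlt => /predU1P[<- //|kj].
  apply: le_trans (IH kj).
  have -> : 2 * j.+1%:Z - 1 = 2 * j%:Z + 1 by lia.
  exact/Gamma_FM_odd_le/hP.
have [j [kj [->|->]]] :
    exists j : nat, (k <= j)%N /\ (n = 2 * j%:Z \/ n = 2 * j%:Z - 1).
  (* Since n >= -1, the quotient is nonnegative; it is j for both n = 2j and n = 2j - 1. *)
  exists (absz ((n + 1) %/ 2)%Z); lia.
- apply: le_trans (odd_le j kj); apply: Gamma_FM_even_le.
  (* P <= H at 2j + 2 says that b_(2j+1) <= b_(2j). *)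
  apply: le_trans (hP j kj) _.
  by rewrite ler_wpM2l ?subr_ge0 // lerD2r ler_int P_le_H.
- exact: odd_le.
Qed.

End Domination.

(** * Thresholds, suprema and the conclusion *)

Lemma b_thr_even_le (R : realType) (k : nat) (beta : R) :
  (b_thr R (2 * k%:Z) <= beta%:E)%E ->
  1 <= beta /\ 2 <= (beta - 1) * ((P (2 * k).+2)%:~R - 1).
Proof.
rewrite /b_thr; case: eqP => [|_]; first by lia.
rewrite dvdz_mulr //.
have -> : 2 * k%:Z + 2 = (2 * k).+2 by lia.
have P2 : 0 < (P (2 * k).+2)%:~R - 1 :> R.
  rewrite subr_gt0 ltr1z PSS.
  by have := P_ge0 (2 * k); have := H_ge1 (2 * k); lia.
rewrite lee_fin -lerBrDl ler_pdivrMr // => h; split=> //.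
(* The product is at least 2 and its second factor is positive, so beta - 1 >= 0. *)
by rewrite -subr_ge0 -(pmulr_lge0 _ P2) (le_trans _ h).
Qed.

Lemma b_thr_odd_le (R : realType) (k : nat) (beta : R) :
  (b_thr R (2 * k%:Z + 1) <= beta%:E)%E ->
  1 <= beta /\ 2 <= (beta - 1) * ((H (2 * k).+2)%:~R - 1).
Proof.
rewrite /b_thr; case: eqP => [|_]; first by lia.
case: ifPn => [|_]; first by lia.
have -> : 2 * k%:Z + 1 + 1 = (2 * k).+2 by lia.
have H2 : 0 < (H (2 * k).+2)%:~R - 1 :> R.
  rewrite subr_gt0 ltr1z HSS.
  by have := P_ge0 (2 * k); have := H_ge1 (2 * k); lia.
rewrite lee_fin -lerBrDl ler_pdivrMr // => h; split=> //.
by rewrite -subr_ge0 -(pmulr_lge0 _ H2) (le_trans _ h).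
Qed.

Lemma ereal_sup_max (R : realType) (T : Type) (A : set T) (f : T -> R) (m : R) :
  (forall x, A x -> f x <= m) -> (exists2 x, A x & f x = m) ->
  ereal_sup [set (f x)%:E | x in A] = m%:E.
Proof.
move=> fm [x Ax fx]; apply/eqP; rewrite eq_le; apply/andP; split.
  by apply: ge_ereal_sup => _ [y Ay <-]; rewrite lee_fin fm.
by apply: ereal_sup_ubound; exists x; rewrite ?fx.
Qed.

Lemma bigmax_FM_ge (R : realType) (F : int -> R) (m : nat) (n : int) :
  -1 <= n -> n < m%:Z ->
  F n <= \big[Num.max/F (-1)]_(0 <= i < m) F i%:Z.
Proof.
case: n => [n|[|//]] n1 nm; last by rewrite bigmax_ge_id.
by apply: bigmax_sup_seq (lexx _) => //; rewrite mem_index_iota; lia.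
Qed.

Lemma bigmax_FM_attained (R : realType) (F : int -> R) (m : nat) :
  exists2 n : int, -1 <= n & F n = \big[Num.max/F (-1)]_(0 <= i < m) F i%:Z.
Proof.
apply: (big_ind (fun x => exists2 n : int, -1 <= n & F n = x)).
- by exists (-1).
- by move=> x y hx hy; rewrite maxEle; case: ifP.
- by move=> i _; exists i%:Z.
Qed.

(* In each maximum, FM_(-1) is the initial value of the iterated max, and the
   index i runs over 0, ..., 2k-1. *)
Theorem proposition3p4 (R : realType) (k : nat) (alpha beta : R)
    (halpha : 1 <= alpha) :
  ((b_thr R (2 * k%:Z) <= beta%:E <= b_thr R (2 * k%:Z - 1))%E ->
    ereal_sup [set (Gamma alpha beta (FM n))%:E | n in [set n : int | -1 <= n]]
    = (\big[Num.max / Gamma alpha beta (FM (-1))]_(0 <= i < 2 * k)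
         Gamma alpha beta (FM i%:Z))%:E) /\
  ((b_thr R (2 * k%:Z + 1) <= beta%:E <= b_thr R (2 * k%:Z))%E ->
    ereal_sup [set (Gamma alpha beta (FM n))%:E | n in [set n : int | -1 <= n]]
    = (Num.max
         (\big[Num.max / Gamma alpha beta (FM (-1))]_(0 <= i < 2 * k)
            Gamma alpha beta (FM i%:Z))
         (Gamma alpha beta (FM (2 * k%:Z + 1))))%:E).
Proof.
set F := fun n : int => Gamma alpha beta (FM n).
have al0 : 0 <= alpha by apply: le_trans halpha.
have maxF n : -1 <= n -> n < (2 * k)%N%:Z ->
    F n <= \big[Num.max/F (-1)]_(0 <= i < 2 * k) F i%:Z.
  exact: bigmax_FM_ge.
have [n0 n0_ge maxE] := bigmax_FM_attained R F (2 * k).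
split=> /andP[].
- move=> /b_thr_even_le[be1 hb] _; apply: ereal_sup_max; last by exists n0.
  move=> n /= n1; have [nk|kn] := ltP n (2 * k)%N%:Z; first exact: maxF.
  (* For k = 0 the index 2k - 1 is that of the initial value of the maximum. *)
  apply: le_trans (maxF (2 * k%:Z - 1) _ _); try lia.
  by apply: Gamma_FM_le => //; lia.
- move=> /b_thr_odd_le[be1 hb] _; apply: ereal_sup_max.
    move=> n /= n1; rewrite le_max; apply/orP.
    have [nk|kn] := ltP n (2 * k)%N%:Z; first by left; exact: maxF.
    (* FM_(2k) is dominated by FM_(2k-1), and every later class by FM_(2k+1). *)
    have [->|nk] := eqVneq n (2 * k%:Z); [left|right].
      apply: le_trans (maxF (2 * k%:Z - 1) _ _); try lia.
      exact: Gamma_FM_even_le.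
    have -> : 2 * k%:Z + 1 = 2 * k.+1%:Z - 1 by lia.
    apply: Gamma_FM_le => //; last by lia.
    (* Domination by FM_(2k+1) asks for beta >= b_(2k+2); this follows from H_(2k+2) <= P_(2k+4). *)
    apply: le_trans hb _; rewrite ler_wpM2l ?subr_ge0 // lerD2r ler_int.
    have -> : (2 * k.+1)%N = (2 * k).+2 by lia.
    by rewrite PSS; have := P_ge0 (2 * k).+2; have := H_ge1 (2 * k).+2; lia.
  rewrite maxEle; case: ifP => _; last by exists n0.
  by exists (2 * k%:Z + 1) => //=; lia.
Qed.
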